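(* Let $d\ge 3$, let $K\subset\mathbb{E}^d$ be a convex body, and let $k$ be an integer with $1\le k\le d-2$. Assume that there exist a $(k+1)$-flat $\Lambda\subset\mathbb{E}^d$ and a point $p\in\Lambda$ such that every $k$-flat $\Gamma$ with $p\in\Gamma\subset\Lambda$ is a $k$-axis of symmetry of $K$. Then $K$ is a $(k+1)$-body of revolution.
   Context: $\mathbb{E}^d$ is $d$-dimensional Euclidean space. A convex body is a compact convex set with non-empty interior. A $k$-flat is a $k$-dimensional affine subspace. $k$-axis of symmetry: for $1\le k\le d-2$, a $k$-flat $\Gamma$ is a $k$-axis of symmetry of $K$ if for every $(k+1)$-flat $\Sigma$ containing $\Gamma$, the section $\Sigma\cap K$ has $\Gamma$ as a hyperplane of symmetry within $\Sigma$, i.e. $\Sigma\cap K$ is invariant under the orthogonal reflection of $\Sigma$ in its hyperplane $\Gamma$. $m$-body of revolution ($1\le m<d$): $K$ is an $m$-body of revolution if there exist an $m$-dimensional linear subspace $V$ and a $(d-m)$-flat $A$ orthogonal to $V$ (that is, a translate of $V^\perp$) such that for every $m$-flat $\Gamma$ parallel to $V$ with $\Gamma\cap K\neq\emptyset$, the set $K\cap\Gamma$ is an $m$-dimensional Euclidean ball (possibly degenerate to a single point) centered at the point $\Gamma\cap A$. *)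

(* Defs.v *)
From HB Require Import structures.
From mathcomp Require Import all_boot all_order all_algebra.
From mathcomp Require Import all_classical all_reals all_analysis.
Import Order.TTheory GRing.Theory Num.Theory.
Import numFieldNormedType.Exports.

Set Implicit Arguments.
Unset Strict Implicit.
Unset Printing Implicit Defensive.

Local Open Scope classical_set_scope.
Local Open Scope ring_scope.

(* Points of E^d are row vectors 'rV[R]_d. The library norm `|x| on 'rV[R]_d is
   the sup norm: it induces the usual topology, hence the usual compact sets
   and interiors, but metric notions have to go through [dotr] and [enorm]. *)
Section Euclidean.
Variables (R : realType) (d : nat).
Implicit Types (u v x y : 'rV[R]_d) (U V : {vspace 'rV[R]_d}).

Definition dotr u v : R := \sum_i u 0 i * v 0 i.

Lemma dotrC u v : dotr u v = dotr v u.
Proof. by apply: eq_bigr => i _; rewrite mulrC. Qed.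

Fact dotr_bilinear : bilinear_for
  (GRing.Scale.Law.clone _ _ *%R _) (GRing.Scale.Law.clone _ _ (idfun \; *%R) _)
  dotr.
Proof.
have lin u : linear_for *%R (dotr ^~ u).
  move=> a v w; rewrite /dotr mulr_sumr -big_split; apply: eq_bigr => i _.
  by rewrite !mxE mulrDl mulrA.
by split=> // u a v w /=; rewrite ![dotr u _]dotrC; exact: lin.
Qed.

HB.instance Definition _ :=
  @bilinear_isBilinear.Build R _ _ _ _ _ dotr dotr_bilinear.

Fact dotr_hermitian u v : dotr u v = (-1) ^+ false * idfun (dotr v u).
Proof. by rewrite expr0 mul1r dotrC. Qed.

HB.instance Definition _ :=
  @isHermitianSesquilinear.Build R _ false idfun dotr dotr_hermitian.

Fact dotr_gt0 u : u != 0 -> 0 < dotr u u.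
Proof.
move=> /rV0Pn[i ui0]; rewrite /dotr (bigD1 i) //= ltr_wpDr //.
  by apply: sumr_ge0 => j _; rewrite -expr2 sqr_ge0.
by rewrite -expr2 lt_def sqrf_eq0 ui0 sqr_ge0.
Qed.

HB.instance Definition _ := isDotProduct.Build R _ dotr dotr_gt0.

Definition enorm u : R := Num.sqrt (dotr u u).

Definition perp V : {vspace 'rV[R]_d} := orthov dotr V.

Lemma perpP V u : reflect (forall v, v \in V -> dotr u v = 0) (u \in perp V).
Proof. exact: mem_orthovP. Qed.

Lemma addv_perp V : (V + perp V)%VS = fullv.
Proof.
pose f u : 'rV[R]_(\dim V) := \row_i dotr u (vbasis V)`_i.
have f_lin : linear f.
  by move=> a u v; apply/rowP => i; rewrite !mxE linearPl.
pose F := GRing.isLinear.Build _ _ _ _ f f_lin.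
pose g : {linear 'rV[R]_d -> 'rV[R]_(\dim V)} := HB.pack f F.
have kerS : (lker (linfun g) <= perp V)%VS.
  apply/subvP => u; rewrite memv_ker lfunE => /eqP/rowP gu0.
  apply/perpP => v /coord_vbasis->; rewrite linear_sumr big1 // => i _.
  by move: (gu0 i); rewrite !mxE linearZ /= => ->; rewrite mulr0.
have dimk := limg_ker_dim (linfun g) fullv.
have dimi : (\dim (linfun g @: fullv) <= \dim V)%N.
  by have := dimvS (subvf (linfun g @: fullv)); rewrite dimvf /dim /= mul1n.
have cap0 : (V :&: perp V = 0)%VS.
  apply/eqP; rewrite -subv0; apply/subvP => u /[!memv_cap]/andP[uV /perpP/(_ u uV)].
  by rewrite memv0; apply: contra_eqT => /dotr_gt0; rewrite lt0r => /andP[].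
apply/eqP; rewrite eqEdim subvf dimv_disjoint_sum //=.
rewrite -dimk capfv addnC leq_add ?dimvS //.
Qed.

Definition flat_at q V : set 'rV[R]_d := [set x | x - q \in V].

Definition is_flat (k : nat) (F : set 'rV[R]_d) : Prop :=
  exists q V, \dim V = k /\ F = flat_at q V.

Definition is_foot (F : set 'rV[R]_d) x y : Prop :=
  F y /\ forall z, F z -> dotr (x - y) (z - y) = 0.

Definition flat_proj (F : set 'rV[R]_d) x : 'rV[R]_d := xget x (is_foot F x).

Lemma flat_projP k F x y :
  is_flat k F -> is_foot F x y <-> y = flat_proj F x.
Proof.
move=> [q [V [_ ->]]].
have uniq y1 y2 : is_foot (flat_at q V) x y1 -> is_foot (flat_at q V) x y2 ->
    y1 = y2.
  move=> [Fy1 o1] [Fy2 o2]; apply/eqP; rewrite -subr_eq0.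
  have /eqP: dotr (y1 - y2) (y1 - y2) = 0.
    rewrite -{1}[y1](subKr x) addrAC linearBl /= o2 // -(opprB y2 y1).
    by rewrite linearNr /= o1 // oppr0 subr0.
  by apply: contraLR => /dotr_gt0; rewrite lt0r => /andP[].
have ex : is_foot (flat_at q V) x (flat_proj (flat_at q V) x).
  have /memv_addP[v vV [w wV xqE]] : x - q \in (V + perp V)%VS.
    by rewrite addv_perp memvf.
  apply: (@xgetPex _ x (is_foot (flat_at q V) x)); exists (q + v).
  split=> [|z zF]; first by rewrite /flat_at /= addrC addKr.
  have -> : x - (q + v) = w by rewrite opprD addrA xqE addrAC subrr add0r.
  by apply: (perpP _ _ wV); rewrite opprD addrA rpredB.
by split=> [yF|->//]; exact: uniq.
Qed.

(* Defined on the whole space; on a flat containing F as a hyperplane it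
   restricts to the orthogonal reflection of that flat in F. *)
Definition flat_refl (F : set 'rV[R]_d) x : 'rV[R]_d :=
  2%:R *: flat_proj F x - x.

Definition convex_body (K : set 'rV[R]_d) : Prop :=
  [/\ compact K, convex_set K & K° !=set0].

Definition axis_of_symmetry (k : nat) (K F : set 'rV[R]_d) : Prop :=
  is_flat k F /\
  forall S, is_flat k.+1 S -> F `<=` S ->
    flat_refl F @` (S `&` K) = S `&` K.

(* The m-flats parallel to V are the [flat_at q V], and the translates of the
   orthogonal complement of V are the [flat_at a (perp V)]. The radius r = 0 is
   the degenerate ball reduced to its center. *)
Definition body_of_revolution (m : nat) (K : set 'rV[R]_d) : Prop :=
  exists V a, \dim V = m /\
    forall q, flat_at q V `&` K !=set0 ->
      exists c r, [/\ flat_at q V `&` flat_at a (perp V) = [set c], 0 <= r &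
        K `&` flat_at q V = [set x | flat_at q V x /\ enorm (x - c) <= r]].

End Euclidean.

(* Main.v *)
Require Import Defs.
From mathcomp Require Import all_boot all_order all_algebra.
From mathcomp Require Import all_classical all_reals all_analysis.
From mathcomp Require Import ring lra.
Import Order.TTheory GRing.Theory Num.Theory.
Import numFieldNormedType.Exports.

Local Open Scope classical_set_scope.
Local Open Scope ring_scope.

(** Take p as origin and let U be the direction of the given (k+1)-flat; write
    every point as p + u + v with u in U and v orthogonal to U.

    A k-flat p + W is a k-axis of symmetry of K exactly when K is stable under
    the reflection of the whole space in p + W: a point x outside p + W
    lies in the (k+1)-flat spanned by p + W and x, and the reflection of that
    flat is the restriction of the global one ([axis_of_symmetry_foot]). If W is
    the hyperplane of U orthogonal to n, this global reflection acts on u as the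
    hyperplane reflection of U along n, and sends v to -v
    ([reflection_invariant]).

    Composing two such maps cancels the sign on v. Since dim U >= 2, for u and w
    in U of equal length there are a reflection of U fixing u and one sending u
    to w, so K contains p + w + v as soon as it contains p + u + v
    ([sphere_invariant]). A point p + w + v with w shorter than u is the midpoint
    of two points of that sphere, so by convexity K contains the whole ball
    ([ball_invariant]). Finally each section of K by a translate of U is compact,
    so it has a point farthest from the center p + v, and the section is the ball
    reaching to that point. *)

(** * Dot product and orthogonal complements *)

Lemma dotr0_eq0 {R : realType} {d : nat} (u : 'rV[R]_d) : dotr u u = 0 -> u = 0.
Proof.
by move/eqP; apply: contraTeq => /dotr_gt0; rewrite lt0r => /andP[].
Qed.

Lemma dotrBZ {R : realType} {d : nat} (u n w : 'rV[R]_d) (a : R) :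
  dotr (u - a *: n) w = dotr u w - a * dotr n w.
Proof. by rewrite linearBl linearZl_LR. Qed.

Lemma dotrDZ {R : realType} {d : nat} (u n : 'rV[R]_d) (a : R) :
  dotr n u = 0 ->
  dotr (u + a *: n) (u + a *: n) = dotr u u + a ^+ 2 * dotr n n.
Proof.
move=> nu; rewrite !linearDl !linearDr /= !linearZl_LR /= !linearZr_LR /=.
by rewrite [dotr u n]dotrC nu; ring.
Qed.

Lemma dotr_sub_sphere {R : realType} {d : nat} (u w : 'rV[R]_d) :
  dotr u u = dotr w w -> dotr (u - w) (u - w) = 2 * dotr u (u - w).
Proof.
by move=> uw; rewrite !linearBl /= !linearBr /= [dotr w u]dotrC uw; ring.
Qed.

Lemma perp_disjoint {R : realType} {d : nat} (V : {vspace 'rV[R]_d})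
  (x : 'rV[R]_d) : x \in V -> x \in perp V -> x = 0.
Proof. by move=> xV /perpP /(_ x xV) /dotr0_eq0. Qed.

Lemma perp_decomp {R : realType} {d : nat} (V : {vspace 'rV[R]_d})
  (x : 'rV[R]_d) : exists u v, [/\ u \in V, v \in perp V & x = u + v].
Proof.
have /memv_addP[u uV [v vV ->]] : x \in (V + perp V)%VS.
  by rewrite addv_perp memvf.
by exists u, v.
Qed.

Lemma perp_mem {R : realType} {d : nat} (V : {vspace 'rV[R]_d})
  (x : 'rV[R]_d) : (forall w, w \in perp V -> dotr x w = 0) -> x \in V.
Proof.
have [u [v [uV vV ->]]] := perp_decomp V x => /(_ v vV).
rewrite linearDl /= [dotr u v]dotrC (perpP _ _ vV _ uV) add0r => /dotr0_eq0 ->.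
by rewrite addr0.
Qed.

(** * Continuity of the dot product and closedness of flats *)

(** Stated coordinatewise, so that only the continuity of sums and products of
    real functions is involved. *)
Lemma dotr_continuous {R : realType} {d : nat} (f g : 'rV[R]_d -> 'rV[R]_d) :
  (forall i, continuous (fun x => f x 0 i)) ->
  (forall i, continuous (fun x => g x 0 i)) ->
  continuous (fun x => dotr (f x) (g x)).
Proof.
move=> cf cg; apply: continuous_big => [|i _ x]; first exact: add_continuous.
exact: (continuousM (cf i x) (cg i x)).
Qed.

Lemma coord_sub_continuous {R : realType} {d : nat} (a : 'rV[R]_d) (i : 'I_d) :
  continuous (fun x : 'rV[R]_d => (x - a) 0 i).
Proof.
have -> : (fun x : 'rV[R]_d => (x - a) 0 i) = (fun x => x 0 i - a 0 i).
  by apply/funext => x; rewrite !mxE.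
move=> x; apply: continuousB; first exact: coord_continuous.
exact: cst_continuous.
Qed.

(** V is its own double orthogonal complement, so a translate of V is cut out by
    the closed conditions of being orthogonal to each vector of [perp V]. *)
Lemma closed_flat_at {R : realType} {d : nat} (q : 'rV[R]_d)
  (V : {vspace 'rV[R]_d}) : closed (flat_at q V).
Proof.
have -> : flat_at q V = \bigcap_(w in [set w | w \in perp V])
    [set x | dotr (x - q) w = 0].
  apply/seteqP; split=> x /= xq => [w /= wV|].
    by rewrite dotrC (perpP _ _ wV).
  by apply: perp_mem => w wV; apply: xq.
apply: closed_bigI => w _.
have cont : continuous (fun x : 'rV[R]_d => dotr (x - q) w).
  apply: dotr_continuous => i; first exact: coord_sub_continuous.
  exact: cst_continuous.
apply: (@preimage_closed _ R (fun x : 'rV[R]_d => dotr (x - q) w) [set 0]).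
  by move=> x _; exact: cont.
exact: closed_eq.
Qed.

(** * Hyperplanes of a subspace *)

(** U is the direct sum of the line of n and of this subspace, the component
    along n being given by orthogonal projection. *)
Lemma dim_normal_hyperplane {R : realType} {d k : nat}
  (U : {vspace 'rV[R]_d}) (n : 'rV[R]_d) :
  \dim U = k.+1 -> n \in U -> n != 0 -> \dim (U :&: perp <[n]>) = k.
Proof.
move=> dU nU n0; set W := (_ :&: _)%VS.
have dn : dotr n n != 0 by rewrite gt_eqF // dotr_gt0.
have dis : (<[n]> :&: W)%VS = 0%VS.
  apply/eqP; rewrite -subv0; apply/subvP => x.
  rewrite memv_cap => /andP[xn /[!memv_cap]/andP[_ /(perp_disjoint _ _ xn) ->]].
  exact: mem0v.
have UE : (<[n]> + W)%VS = U.
  apply/eqP; rewrite eqEsubv subv_add capvSl -memvE nU /=.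
  apply/subvP => u uU; apply/memv_addP.
  exists ((dotr u n / dotr n n) *: n); first exact/memvZ/memv_line.
  exists (u - (dotr u n / dotr n n) *: n); last by rewrite addrC subrK.
  rewrite memv_cap memvB ?memvZ //=; apply/perpP => _ /vlineP[a ->].
  by rewrite linearZr_LR /= dotrBZ divfK // subrr mulr0.
by move: dU; rewrite -UE (dimv_disjoint_sum dis) dim_vline n0 => -[].
Qed.

Lemma exists_orthogonal {R : realType} {d : nat} (U : {vspace 'rV[R]_d})
  (u : 'rV[R]_d) :
  (1 < \dim U)%N -> u \in U -> exists2 n, n \in U & n != 0 /\ dotr n u = 0.
Proof.
move=> dU uU; have [->|u0] := eqVneq u 0.
  exists (vpick U); first exact: memv_pick.
  by rewrite linear0r vpick0 -dimv_eq0 -lt0n (ltnW dU).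
have dW := dim_normal_hyperplane U u (esym (prednK (ltnW dU))) uU u0.
set W := (_ :&: _)%VS in dW.
have := memv_pick W; rewrite memv_cap => /andP[nU /perpP nu].
exists (vpick W) => //; split; last exact/nu/memv_line.
by rewrite vpick0 -dimv_eq0 dW -lt0n -ltnS prednK // ltnW.
Qed.

(** * Reflections in axes of symmetry *)

(** The condition on sections gives a symmetry of K in the whole space: the
    section through x used here is the flat spanned by x and the axis, and a
    point of the axis is its own image. *)
Lemma axis_of_symmetry_foot {R : realType} {d k : nat} (K : set 'rV[R]_d)
  (p : 'rV[R]_d) (W : {vspace 'rV[R]_d}) (x y : 'rV[R]_d) :
  \dim W = k -> axis_of_symmetry k K (flat_at p W) ->
  K x -> is_foot (flat_at p W) x y -> K (2 *: y - x).
Proof.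
move=> dW [Wk sym] Kx xy.
have yE := (flat_projP _ _ Wk).1 xy.
have [xW|xW] := boolP (x - p \in W).
  have xx : is_foot (flat_at p W) x x.
    by split=> // z _; rewrite subrr linear0l.
  rewrite yE -((flat_projP _ _ Wk).1 xx).
  by rewrite scaler_nat mulr2n addrK.
have x0 : x - p != 0 by apply: contraNneq xW => ->; exact: mem0v.
have dS : \dim (W + <[x - p]>) = k.+1.
  rewrite dimv_disjoint_sum ?dim_vline ?x0 ?dW ?addn1 //.
  apply/eqP; rewrite -subv0; apply/subvP => z.
  rewrite memv_cap => /andP[zW /vlineP[a zE]]; rewrite memv0 zE.
  have [->|a0] := eqVneq a 0; first by rewrite scale0r.
  case/negP: xW; rewrite -(scalerK a0 (x - p)) -zE; exact: memvZ.
have sub : flat_at p W `<=` flat_at p (W + <[x - p]>).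
  by move=> z; apply: subvP; exact: addvSl.
have := sym _ (ex_intro _ p (ex_intro _ _ (conj dS erefl))) sub.
move/seteqP => [+ _] => /(_ (flat_refl (flat_at p W) x)) [].
  exists x => //; split=> //; apply: (subvP (addvSr W <[x - p]>)).
  exact: memv_line.
by rewrite /flat_refl -yE.
Qed.

(** The orthogonal reflection in the hyperplane normal to n. *)
Definition reflect_along {R : realType} {d : nat} (n u : 'rV[R]_d) :=
  u - (2 * dotr u n / dotr n n) *: n.

Lemma reflect_along_fix {R : realType} {d : nat} (n u : 'rV[R]_d) :
  dotr n u = 0 -> reflect_along n u = u.
Proof.
by move=> nu; rewrite /reflect_along dotrC nu mulr0 mul0r scale0r subr0.
Qed.

Lemma reflect_along_sphere {R : realType} {d : nat} (u w : 'rV[R]_d) :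
  u != w -> dotr u u = dotr w w -> reflect_along (u - w) u = w.
Proof.
rewrite -subr_eq0 => /dotr_gt0 /gt_eqF /negbT n0 uw.
by rewrite /reflect_along -dotr_sub_sphere // divff // scale1r subKr.
Qed.

Definition axes_in_flat {R : realType} {d : nat} (k : nat) (K : set 'rV[R]_d)
  (p : 'rV[R]_d) (U : {vspace 'rV[R]_d}) :=
  forall W, (W <= U)%VS -> \dim W = k -> axis_of_symmetry k K (flat_at p W).

(** The axis is p + W with W the hyperplane of U normal to n. Its orthogonal
    complement contains n and all of [perp U], which is why v changes sign. *)
Lemma reflection_invariant {R : realType} {d k : nat} (K : set 'rV[R]_d)
  (p : 'rV[R]_d) (U : {vspace 'rV[R]_d}) :
  \dim U = k.+1 ->
  axes_in_flat k K p U ->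
  forall n u v, n \in U -> n != 0 -> u \in U -> v \in perp U ->
    K (p + (u + v)) -> K (p + (reflect_along n u - v)).
Proof.
move=> dU sym n u v nU n0 uU vU Kx.
have dn : dotr n n != 0 by rewrite gt_eqF // dotr_gt0.
have dW := dim_normal_hyperplane U n dU nU n0.
set W := (_ :&: _)%VS in dW.
pose a := dotr u n / dotr n n; pose w := u - a *: n.
have wW : w \in W.
  rewrite memv_cap memvB ?memvZ //=; apply/perpP => _ /vlineP[b ->].
  by rewrite linearZr_LR /= dotrBZ divfK // subrr mulr0.
have foot : is_foot (flat_at p W) (p + (u + v)) (p + w).
  split=> [|z zW]; first by rewrite /flat_at /= addrC addKr.
  have : z - (p + w) \in W by rewrite opprD addrA memvB.
  move: (z - (p + w)) => t; rewrite memv_cap => /andP[tU /perpP tn].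
  have -> : p + (u + v) - (p + w) = v + a *: n.
    by rewrite /w; apply/rowP => i; rewrite !mxE; ring.
  rewrite linearDl linearZl_LR /= (perpP _ _ vU) // [dotr n t]dotrC.
  by rewrite tn ?memv_line // mulr0 addr0.
have := axis_of_symmetry_foot _ _ _ _ _ dW (sym W (capvSl _ _) dW) Kx foot.
congr K; rewrite /w /reflect_along /a -mulrA.
by apply/rowP => i; rewrite !mxE; ring.
Qed.

(** * Spheres and balls in the sections *)

(** A reflection along some n orthogonal to u, which exists because
    dim U >= 2, sends u + v to u - v; the reflection along u - w then sends
    u - v to w + v. *)
Lemma sphere_invariant {R : realType} {d k : nat} (K : set 'rV[R]_d)
  (p : 'rV[R]_d) (U : {vspace 'rV[R]_d}) :
  (0 < k)%N -> \dim U = k.+1 ->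
  axes_in_flat k K p U ->
  forall u w v, u \in U -> w \in U -> v \in perp U -> dotr u u = dotr w w ->
    K (p + (u + v)) -> K (p + (w + v)).
Proof.
move=> k0 dU sym u w v uU wU vU uw Kx.
have [<-//|neq] := eqVneq u w.
have dU1 : (1 < \dim U)%N by rewrite dU ltnS.
have [n nU [n0 nu]] := exists_orthogonal U u dU1 uU.
have refl := reflection_invariant K p U dU sym.
have := refl n u v nU n0 uU vU Kx; rewrite reflect_along_fix // => Kx'.
have := refl (u - w) u (- v).
rewrite reflect_along_sphere // opprK; apply=> //.
- exact: memvB.
- by rewrite subr_eq0.
- by rewrite memvN.
Qed.

Lemma convex_midpoint {R : realType} {d : nat} (K : set 'rV[R]_d)
  (x y : 'rV[R]_d) : convex_set K -> K x -> K y -> K (2^-1 *: (x + y)).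
Proof.
move=> cK Kx Ky.
have h0 : 0 <= 2^-1 :> R by lra.
have h1 : 2^-1 <= 1 :> R by lra.
have := cK x y (Itv01 h0 h1) (mem_set Kx) (mem_set Ky).
move/set_mem; congr K; rewrite scalerDr.
by congr (_ + _ *: _) => /=; rewrite /unstable.onem; lra.
Qed.

(** For n in U orthogonal to w and a suitable s, the points w + s n and w - s n
    have the length of u, and w is their midpoint. *)
Lemma ball_invariant {R : realType} {d k : nat} (K : set 'rV[R]_d)
  (p : 'rV[R]_d) (U : {vspace 'rV[R]_d}) :
  (0 < k)%N -> \dim U = k.+1 -> convex_set K ->
  axes_in_flat k K p U ->
  forall u w v, u \in U -> w \in U -> v \in perp U -> dotr w w <= dotr u u ->
    K (p + (u + v)) -> K (p + (w + v)).
Proof.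
move=> k0 dU cK sym u w v uU wU vU uw Kx.
have dU1 : (1 < \dim U)%N by rewrite dU ltnS.
have [n nU [n0 nw]] := exists_orthogonal U w dU1 wU.
have dn := dotr_gt0 n0.
pose s := Num.sqrt ((dotr u u - dotr w w) / dotr n n).
have s2 : s ^+ 2 * dotr n n = dotr u u - dotr w w.
  by rewrite sqr_sqrtr ?divfK ?gt_eqF // divr_ge0 ?subr_ge0 // ltW.
have on_sphere e : e ^+ 2 = s ^+ 2 -> K (p + (w + e *: n + v)).
  move=> e2; apply: (sphere_invariant K p U k0 dU sym u) => //.
    by rewrite memvD ?memvZ.
  by rewrite dotrDZ // e2 s2 addrC subrK.
have := convex_midpoint _ _ _ cK (on_sphere s erefl) (on_sphere _ (sqrrN s)).
by congr K; apply/rowP => i; rewrite !mxE; field.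
Qed.

Theorem theorem2 (R : realType) (d k : nat) (K : set 'rV[R]_d)
  (hd : (3 <= d)%N) (hk1 : (1 <= k)%N) (hk2 : (k <= d - 2)%N)
  (hK : convex_body K)
  (hL : exists (L : set 'rV[R]_d) (p : 'rV[R]_d),
      [/\ is_flat k.+1 L, L p &
        forall G : set 'rV[R]_d, is_flat k G -> G p -> G `<=` L ->
          axis_of_symmetry k K G]) :
  body_of_revolution k.+1 K.
Proof.
case: hK => compK convK _.
case: hL => L [p [[q0 [U [dU ->]]] Lp sym0]].
have sym : axes_in_flat k K p U.
  move=> W WU dW; apply: sym0; first by exists p, W.
    by rewrite /flat_at /= subrr mem0v.
  move=> x /(subvP WU) xU; rewrite /flat_at /= -(subrK p x) -addrA.
  exact: memvD.
have ball := ball_invariant K p U hk1 dU convK sym.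
exists U, p; split=> // q meet.
have [u0 [v0 [u0U v0U qE]]] := perp_decomp U (q - p).
pose c := p + v0.
have inU z : flat_at q U z <-> z - c \in U.
  have -> : z - c = (z - q) + u0.
    have -> : u0 = q - p - v0 by rewrite qE addrK.
    by rewrite /c; apply/rowP => i; rewrite !mxE; ring.
  by rewrite /flat_at /= (rpredDr _ u0U).
have splitz z : z = p + (z - c + v0).
  by rewrite /c; apply/rowP => i; rewrite !mxE; ring.
have cont : continuous (fun z : 'rV[R]_d => dotr (z - c) (z - c)).
  by apply: dotr_continuous => i; exact: coord_sub_continuous.
have cS : compact (K `&` flat_at q U).
  exact: compact_closedI compK (closed_flat_at q U).
have S0 : (K `&` flat_at q U) !=set0 by rewrite setIC.
have [m /set_mem[Km /inU mU] mmax] :=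
  compact_EVT_max S0 cS (continuous_subspaceT cont).
exists c, (enorm (m - c)); split; last first.
- apply/seteqP; split=> z [].
    move=> Kz zq; split=> //; rewrite /enorm ler_wsqrtr //.
    by apply: mmax; apply/mem_set.
  move=> zq; rewrite /enorm ler_sqrt; last first.
    have [->|/dotr_gt0/ltW//] := eqVneq (m - c) 0; by rewrite linear0l.
  move=> zm; split=> //; rewrite [z]splitz.
  by apply: (ball (m - c)) => //; [exact/inU|rewrite -splitz].
- exact: sqrtr_ge0.
apply/seteqP; split=> z /=.
  move=> [/inU zU zp]; apply/eqP; rewrite -subr_eq0; apply/eqP.
  apply: (perp_disjoint _ _ zU).
  by rewrite /c opprD addrA memvB.
move=> ->; split; first by apply/inU; rewrite subrr mem0v.
by rewrite /flat_at /= /c addrC addKr.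
Qed.
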